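(* Given an integer $k\ge 2$, let $m_k=\min\{m: \binom{m}{\lfloor m/2\rfloor}\ge k\}$. For any poset $P$ we have $$RR^{*}(P,A_k)\le \lfloor (k-1)\lambda^*_{max}(P)\rfloor+m_k.$$ Moreover, if $P$ is not $C_1$ or $C_2$, then $$RR^{*}(P,A_3)\le \lfloor 2\lambda^*_{max}(P)\rfloor+2.$$
   Context: All posets are finite and non-empty. $B_n$ is the Boolean lattice of all subsets of $[n]=\{1,\dots,n\}$ ordered by inclusion. $C_l$ is the chain on $l$ elements and $A_k$ is the antichain on $k$ elements. A subset $X$ of a poset $R$ is a strong (induced) copy of a poset $P$ if there is a bijection $\alpha:P\to X$ such that $p\le_P p'$ if and only if $\alpha(p)\le_R\alpha(p')$. A copy is monochromatic with respect to a coloring if all its elements have the same color, and rainbow if its elements have pairwise distinct colors. The strong rainbow Ramsey number $RR^*(P,Q)$ is the minimum $n$ such that any coloring of $B_n$ (with colors from $\mathbb{N}$, any number of colors) admits either a monochromatic strong copy of $P$ or a rainbow strong copy of $Q$. The Lubell-mass of $\mathcal{F}\subseteq B_n$ is $\lambda_n(\mathcal{F})=\sum_{F\in\mathcal{F}}\binom{n}{|F|}^{-1}$. $\lambda^*_n(P)$ is the maximum of $\lambda_n(\mathcal{F})$ over all families $\mathcal{F}\subseteq B_n$ containing no strong copy of $P$, and $\lambda^*_{max}(P)=\sup_n\lambda^*_n(P)$, which is known to be finite for every poset $P$ (a theorem of M\'eroueh). *)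

(* Defs.v *)
From HB Require Import structures.
From mathcomp Require Import all_boot all_order all_algebra.
From mathcomp Require Import boolp classical_sets reals ereal.

Set Implicit Arguments.
Unset Strict Implicit.
Unset Printing Implicit Defensive.

Import Order.TTheory GRing.Theory Num.Theory.
Local Open Scope ring_scope.

Import Order.DefaultSetSubsetOrder.

Definition boolean_lattice (n : nat) := {set 'I_n}.
HB.instance Definition _ n :=
  Order.FinPOrder.copy (boolean_lattice n) {set 'I_n}.

Definition chain (l : nat) := 'I_l.
HB.instance Definition _ l := Order.FinPOrder.copy (chain l) 'I_l.

(* ['I_k] is already totally ordered, hence a fresh alias for the antichain. *)
Definition antichain (k : nat) := 'I_k.
HB.instance Definition _ k := Finite.on (antichain k).

Fact antichain_display : Order.disp_t. Proof. exact: Order.Disp tt tt. Qed.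

Section AntichainOrder.
Variable k : nat.
Implicit Types x y z : antichain k.

Fact antichain_anti : antisymmetric (@eq_op (antichain k)).
Proof. by move=> x y /andP[/eqP]. Qed.

Fact antichain_trans : transitive (@eq_op (antichain k)).
Proof. by move=> y x z /eqP-> /eqP->. Qed.

HB.instance Definition _ := Order.Le_isPOrder.Build antichain_display
  (antichain k) (@eqxx (antichain k)) antichain_anti antichain_trans.

End AntichainOrder.

Definition isomorphic (dP dQ : Order.disp_t) (P : finPOrderType dP)
    (Q : finPOrderType dQ) : Prop :=
  exists2 f : P -> Q, bijective f & {mono f : x y / (x <= y)%O}.

Definition strong_copy (dP dR : Order.disp_t) (P : finPOrderType dP)
    (R : finPOrderType dR) (X : {set R}) : Prop :=
  exists alpha : P -> R,
    [/\ injective alpha, alpha @: [set: P] = X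
      & {mono alpha : p p' / (p <= p')%O}].

Definition monochromatic (T : finType) (c : T -> nat) (X : {set T}) : Prop :=
  {in X &, forall x y, c x = c y}.

Definition rainbow (T : finType) (c : T -> nat) (X : {set T}) : Prop :=
  {in X &, injective c}.

Definition rainbow_arrows (dP dQ : Order.disp_t) (P : finPOrderType dP)
    (Q : finPOrderType dQ) (n : nat) : Prop :=
  forall c : boolean_lattice n -> nat,
    (exists2 X : {set boolean_lattice n}, strong_copy P X & monochromatic c X)
 \/ (exists2 X : {set boolean_lattice n}, strong_copy Q X & rainbow c X).

(* The minimum of the empty set is [+oo]: for general [P] and [Q] there need
   not be any [n] such that [rainbow_arrows P Q n]. *)
Definition RRstar (R : realType) (dP dQ : Order.disp_t) (P : finPOrderType dP)
    (Q : finPOrderType dQ) : \bar R :=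
  if pselect (exists n, `[< rainbow_arrows P Q n >]) is left h
  then (ex_minn h)%:R%:E else +oo%E.

Definition lubell_mass (R : realType) (n : nat)
    (F : {set boolean_lattice n}) : R :=
  \sum_(A in F) ('C(n, #|(A : {set 'I_n})|)%:R)^-1.

Definition strong_free (dP : Order.disp_t) (P : finPOrderType dP) (n : nat)
    (F : {set boolean_lattice n}) : Prop :=
  forall X : {set boolean_lattice n}, X \subset F -> ~ strong_copy P X.

(* For non-empty [P] the empty family is [strong_free] and has mass 0, so the
   default value 0 of the iterated maximum does not affect it. *)
Definition lambda_star (R : realType) (dP : Order.disp_t)
    (P : finPOrderType dP) (n : nat) : R :=
  \big[Num.max/0]_(F : {set boolean_lattice n} | `[< strong_free P F >])
    lubell_mass R F.

(* Finite for every [P] by a theorem of Meroueh; the supremum is taken in the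
   extended reals because [sup] on [R] would be 0 on an unbounded set. *)
Definition lambda_star_max (R : realType) (dP : Order.disp_t)
    (P : finPOrderType dP) : \bar R :=
  ereal_sup (range (fun n : nat => (lambda_star R P n)%:E)).

Definition efloor (R : realType) (x : \bar R) : \bar R :=
  er_map (fun r : R => (Num.floor r)%:~R) x.

Fact ex_central_bin (k : nat) : exists m : nat, (k <= 'C(m, m./2))%N.
Proof.
case: k => [|k]; first by exists 0.
suff bin_ge: forall n i, (0 < i < n)%N -> (n <= 'C(n, i))%N.
  exists k.+3; apply: leq_trans (bin_ge _ _ _); first exact: leqW.
  by rewrite half_gt0 /= !ltnS leq_uphalf_double -addnn addSnnS leq_addr.
elim=> [|n IHn] [|i] //; rewrite ltnS => /= lt_in.
rewrite binS -(addn1 n); case: (ltnP i.+1 n) => [i1n|le_ni].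
  by rewrite leq_add ?IHn // bin_gt0 ltnW.
have ->: n = i.+1 by apply/eqP; rewrite eqn_leq le_ni -ltnS lt_in.
by rewrite binn binSn addnC.
Qed.

Definition central_bin_min (k : nat) : nat := ex_minn (ex_central_bin k).

(* Main.v *)
(** If [D] and [D'] are incomparable subsets of [[m]], every set [D ∪ T] is
    incomparable to every set [D' ∪ T'], where [T, T' ⊆ [m+1, m+d]].  So
    [B_(m+d)] contains ['C(m, m/2)] pairwise incomparable copies of [B_d].
    Without a monochromatic copy of [P] each colour class has Lubell mass at
    most [λ*_max(P)] in each such copy, whose total mass is [d+1]; if
    [d+1 > (k-1) λ*_max(P)], each copy sees at least [k] colours, and a rainbow
    antichain is chosen greedily, one set from each copy.

    For [k = 3] take [m = 2].  Two incomparable sets of distinct colours in one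
    copy could be completed by a set of a third colour in the other copy; so
    incomparable sets of one copy share their colour, which makes the copy
    monochromatic except for its least and greatest elements.  This class has
    mass at least [d-1], which is too large because [λ*_max(P) >= 2]: all of
    [B_1] is free of [P] unless [P] is [C_1] or [C_2]. *)
Require Import Defs.
From mathcomp Require Import all_boot all_order all_algebra.
From mathcomp Require Import boolp classical_sets reals ereal.
From mathcomp Require Import lra.

Set Implicit Arguments.
Unset Strict Implicit.
Unset Printing Implicit Defensive.

Import fintype boot.finset Order.TTheory GRing.Theory Num.Theory.
Local Open Scope ring_scope.

Lemma le_boolean_lattice n (A B : boolean_lattice n) :
  (A <= B)%O = ((A : {set 'I_n}) \subset B).
Proof. by []. Qed.

Lemma le_antichain k (x y : antichain k) : (x <= y)%O = (x == y).
Proof. by []. Qed.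

Lemma le_chain l (x y : chain l) : (x <= y)%O = (x <= y)%N.
Proof. by []. Qed.

(** * Copies of [B_d] inside [B_(m+d)] *)

Section Embedding.
Variables m d : nat.

Definition cube_embed (D : {set 'I_m}) (T : boolean_lattice d) :
    boolean_lattice (m + d) :=
  [set i : 'I_(m + d) |
     match split i with inl j => j \in D | inr j => j \in (T : {set 'I_d}) end].

Lemma cube_embed_le D D' T T' :
  (cube_embed D T <= cube_embed D' T')%O = (D \subset D') && (T <= T')%O.
Proof.
rewrite !le_boolean_lattice; apply/subsetP/andP => [sub|[/subsetP sD /subsetP sT] i].
  split; apply/subsetP => j jin.
    by have := sub (lshift d j); rewrite !inE (unsplitK (inl j)); apply.
  by have := sub (rshift m j); rewrite !inE (unsplitK (inr j)); apply.
by rewrite !inE; case: split => j; [apply: sD | apply: sT].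
Qed.

End Embedding.

Definition mono_free (dP : Order.disp_t) (P : finPOrderType dP) n
    (c : boolean_lattice n -> nat) :=
  ~ exists2 X : {set boolean_lattice n}, strong_copy P X & monochromatic c X.

(** For fixed [D], [T ↦ D ∪ T] is an order embedding, so it carries monochromatic copies of [P] to
    monochromatic copies. *)
Lemma mono_free_embed (dP : Order.disp_t) (P : finPOrderType dP) m d
    (D : {set 'I_m}) (c : boolean_lattice (m + d) -> nat) :
  mono_free P c -> mono_free P (c \o @cube_embed m d D).
Proof.
move=> free [X [a [a_inj aX a_mono]] monoX]; apply: free.
have e_mono : {mono @cube_embed m d D : T T' / (T <= T')%O}.
  by move=> T T'; rewrite cube_embed_le subxx.
exists (@cube_embed m d D @: X).
  exists (@cube_embed m d D \o a); split.
  - exact: inj_comp (inc_inj e_mono) a_inj.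
  - by rewrite imset_comp aX.
  - by move=> p p' /=; rewrite e_mono a_mono.
by move=> _ _ /imsetP[T TX ->] /imsetP[T' TX' ->]; apply: monoX.
Qed.

(** * Rainbow antichains and greedy choice *)

Lemma rainbow_antichain n k (c : boolean_lattice n -> nat)
    (x : 'I_k -> boolean_lattice n) :
  (forall i j, (x i <= x j)%O -> i = j) -> injective (c \o x) ->
  exists2 X : {set boolean_lattice n},
    strong_copy (antichain k) X & rainbow c X.
Proof.
move=> x_anti cx_inj; exists (x @: [set: 'I_k]).
  exists x; split=> //; first by move=> i j eq_ij; apply: cx_inj; rewrite /= eq_ij.
  move=> i j; rewrite le_antichain; apply/idP/eqP => [/x_anti //|->]; exact: lexx.
by move=> _ _ /imsetP[i _ ->] /imsetP[j _ ->] /cx_inj ->.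
Qed.

(** Before stage [j < k] only [j] colours are in use, so the hypothesis supplies a choice avoiding
    all of them. *)
Lemma greedy_distinct (T : Type) (col : nat -> T -> nat) k :
  (0 < k)%N ->
  (forall i s, (size s < k)%N -> exists t, col i t \notin s) ->
  exists g : nat -> T, {in gtn k &, injective (fun i => col i (g i))}.
Proof.
move=> k_gt0 many; have [t0 _] := many 0 [::] k_gt0.
suff: forall j, (j <= k)%N ->
    exists g : nat -> T, {in gtn j &, injective (fun i => col i (g i))}.
  by apply.
elim=> [|j IHj] jk; first by exists (fun=> t0).
have [g g_inj] := IHj (ltnW jk).
have [|t t_new] := many j [seq col i (g i) | i <- iota 0 j].
  by rewrite size_map size_iota.
have fresh i : (i < j)%N -> col i (g i) <> col j t.
  move=> ij eq_col; move/negP: t_new; apply; rewrite -eq_col.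
  by apply/mapP; exists i; rewrite ?mem_iota.
exists (fun i => if i == j then t else g i) => i i'.
rewrite !inE /= !ltnS (leq_eqVlt i) (leq_eqVlt i').
case: (eqVneq i j) => [->|_] /=; case: (eqVneq i' j) => [->|_] //=.
- by move=> _ i'j /esym /fresh; case.
- by move=> ij _ /fresh; case.
- by move=> ij i'j; apply: g_inj.
Qed.

(** * Lubell mass of colour classes *)

Section Mass.
Variable R : realType.

(** Each of the [n + 1] levels has mass 1. *)
Lemma lubell_mass_setT n : lubell_mass R [set: boolean_lattice n] = n.+1%:R.
Proof.
rewrite /lubell_mass.
transitivity (\sum_(A : {set 'I_n}) ('C(n, #|A|)%:R : R)^-1).
  by apply: eq_bigl => A; rewrite inE.
have card_lt (A : {set 'I_n}) : (#|A| < n.+1)%N.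
  by rewrite ltnS -[X in (_ <= X)%N]card_ord max_card.
rewrite (partition_big (fun A => Ordinal (card_lt A)) predT) //=.
rewrite (eq_bigr (fun=> 1)) => [|i _]; first by rewrite sumr_const card_ord.
rewrite (eq_bigr (fun=> ('C(n, i)%:R)^-1)) => [|A /eqP <- //].
rewrite sumr_const -[RHS](@mulVf _ ('C(n, i)%:R)).
  rewrite -[LHS]mulr_natr; congr (_ * _%:R).
  have := card_draws 'I_n i; rewrite card_ord cardsE => <-; apply: eq_card => A.
  by rewrite !unfold_in.
by rewrite pnatr_eq0 -lt0n bin_gt0 -ltnS.
Qed.

Lemma lubell_weight_ge0 n (A : boolean_lattice n) :
  0 <= ('C(n, #|(A : {set 'I_n})|)%:R : R)^-1.
Proof. by rewrite invr_ge0 ler0n. Qed.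

Variables (dP : Order.disp_t) (P : finPOrderType dP).

Lemma lubell_mass_strong_free n (F : {set boolean_lattice n}) :
  strong_free P F -> lubell_mass R F <= lambda_star R P n.
Proof. by move=> /asboolP freeF; apply: le_bigmax_cond. Qed.

Lemma lubell_mass_monochromatic n (c : boolean_lattice n -> nat)
    (F : {set boolean_lattice n}) :
  mono_free P c -> monochromatic c F -> lubell_mass R F <= lambda_star R P n.
Proof.
move=> free monoF; apply: lubell_mass_strong_free => X /subsetP XF copyX.
by apply: free; exists X => // A B /XF AF /XF BF; apply: monoF.
Qed.

(** If [s] held every colour, its colour classes, each of mass at most [lambda_star R P n], would
    cover a total mass of [n + 1]. *)
Lemma new_colour n (c : boolean_lattice n -> nat) (s : seq nat) :
  mono_free P c -> (size s)%:R * lambda_star R P n < n.+1%:R ->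
  exists A, c A \notin s.
Proof.
move=> free; apply: contraPP => no_new; apply/negP; rewrite -leNgt.
have all_s A : c A \in s.
  by apply/negPn/negP => cA; apply: no_new; exists A.
rewrite -lubell_mass_setT.
apply: (@le_trans _ _ (\sum_(a <- s) lubell_mass R [set A | c A == a])).
  rewrite /lubell_mass (eq_bigr (fun a => \sum_A
    if c A == a then ('C(n, #|(A : {set 'I_n})|)%:R : R)^-1 else 0)); last first.
    by move=> a _; rewrite -big_mkcond; apply: eq_bigl => A; rewrite inE.
  rewrite exchange_big /= [leLHS](eq_bigl predT) => [|A]; last by rewrite inE.
  apply: ler_sum => A _.
  (* One occurrence of [c A] already accounts for the weight of [A]; since [s] may repeat colours,
     the other terms are only known to be nonnegative. *)
  rewrite (big_rem (c A)) //= eqxx lerDl; apply: sumr_ge0 => a _.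
  by case: ifP => // _; apply: lubell_weight_ge0.
rewrite mulr_natl -iter_addr_0 -count_predT -big_const_seq; apply: ler_sum => a _.
by apply: (lubell_mass_monochromatic free) => A B; rewrite !inE => /eqP-> /eqP->.
Qed.

(** * Arrow relations for antichains *)

Lemma rainbow_arrows_antichain d k :
  (2 <= k)%N -> (k%:R - 1) * lambda_star R P d < d.+1%:R ->
  rainbow_arrows P (antichain k) (central_bin_min k + d).
Proof.
move=> k_ge2 lt_mass c; have [mono|free] := pselect
    (exists2 X : {set boolean_lattice _}, strong_copy P X & monochromatic c X).
  by left.
right; rewrite /central_bin_min in c free *; case: ex_minnP c free => m k_le _ c free.
have lam_ge0 : 0 <= lambda_star R P d by apply: bigmax_ge_id.
(* The middle level of [B_m] supplies at least [k] pairwise incomparable sets [D]. *)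
pose E : seq {set 'I_m} := enum [set A : {set 'I_m} | #|A| == m./2].
have sizeE : size E = 'C(m, m./2) by rewrite -cardE card_draws card_ord.
have [|i s s_lt|g g_inj] := @greedy_distinct (boolean_lattice d)
    (fun i T => c (cube_embed (nth set0 E i) T)) k.
- exact: ltnW.
- apply: (new_colour (mono_free_embed free)); apply: le_lt_trans lt_mass.
  by rewrite ler_wpM2r // lerBrDr natr1 ler_nat.
have E_lt (i : 'I_k) : (i < size E)%N.
  by rewrite sizeE; apply: leq_trans (ltn_ord i) k_le.
have E_card (i : 'I_k) : #|nth set0 E i| = m./2.
  by have := mem_nth set0 (E_lt i); rewrite mem_enum inE => /eqP.
apply: (@rainbow_antichain _ _ _
  (fun i : 'I_k => cube_embed (nth set0 E i) (g i))) => [i j|i j /=].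
  (* Inclusion between two sets of the same size is equality. *)
  rewrite cube_embed_le => /andP[sub _]; apply/val_inj/eqP => /=.
  rewrite -(nth_uniq set0 (E_lt i) (E_lt j)) ?enum_uniq //.
  by rewrite eqEcard sub !E_card leqnn.
by move/g_inj => /= ij; apply/val_inj/ij; rewrite inE ltn_ord.
Qed.

(** Of the total mass [d + 1], only the empty and the full set, of weight 1 each, can be missing
    from [F]. *)
Lemma lubell_mass_middle d (F : {set boolean_lattice d}) :
  (forall A : {set 'I_d}, A != set0 -> A != [set: 'I_d] -> A \in F) ->
  d%:R - 1 <= lubell_mass R F.
Proof.
move=> middle; suff: lubell_mass R [set: boolean_lattice d] <=
    lubell_mass R F + 1 + 1 by rewrite lubell_mass_setT -natr1; lra.
pose w (A : {set 'I_d}) : R := ('C(d, #|A|)%:R)^-1.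
have w_ge0 A : 0 <= w A by apply: lubell_weight_ge0.
have -> : lubell_mass R F + 1 + 1 = \sum_(A : {set 'I_d})
    ((if A \in F then w A else 0) + (if A == set0 then w A else 0)
      + (if A == [set: 'I_d] then w A else 0)).
  rewrite !big_split /= -!big_mkcond !big_pred1_eq /w cards0 cardsT card_ord.
  by rewrite bin0 binn invr1.
rewrite /lubell_mass [leLHS](eq_bigl predT) => [|A]; last by rewrite inE.
apply: ler_sum => A _; rewrite -/(w A).
have := w_ge0 A; move: (w A) (middle A) => wA mid wA_ge0.
case: eqVneq mid => [_|_] mid; case: eqVneq mid => [_|_] mid;
  case: ifP mid => _ mid; lra.
Qed.

Lemma rainbow_arrows_antichain3 d :
  2 * lambda_star R P d < d.+1%:R -> lambda_star R P d < d%:R - 1 ->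
  rainbow_arrows P (antichain 3) (2 + d).
Proof.
move=> lt_mass lt_middle c; apply/or_asboolP/negPn/negP.
move=> /or_asboolP/not_orP[free no_rainbow].
have d_gt1 : (1 < d)%N.
  have lam_ge0 : 0 <= lambda_star R P d by apply: bigmax_ge_id.
  by rewrite -(ltr_nat R); lra.
(* The two copies of [B_d] sit over the two singletons of [[2]]. *)
pose e (i : 'I_2) : boolean_lattice d -> boolean_lattice (2 + d) :=
  cube_embed [set i].
have e_le i j A B : (e i A <= e j B)%O = (i == j) && (A <= B)%O.
  by rewrite cube_embed_le sub1set inE.
have same_colour A B : ~~ (A <= B)%O -> ~~ (B <= A)%O ->
    c (e ord0 A) = c (e ord0 B).
  move=> nAB nBA; apply/eqP/negPn/negP => neq_col.
  have [Z] := new_colour (s := [:: c (e ord0 A); c (e ord0 B)])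
    (mono_free_embed (D := [set ord_max]) free) lt_mass.
  rewrite /= !inE negb_or -/(e ord_max Z) => /andP[neqZA neqZB].
  apply: no_rainbow; pose x := [:: e ord0 A; e ord0 B; e ord_max Z].
  apply: (@rainbow_antichain _ _ _ (fun i => nth (e ord0 A) x i)).
    move=> [[|[|[|i]]] //= i3] [[|[|[|j]]] //= j3]; rewrite e_le;
      by rewrite ?(negPf nAB) ?(negPf nBA) //= => _; apply: val_inj.
  move=> [[|[|[|i]]] //= i3] [[|[|[|j]]] //= j3] eq_col;
    by [apply: val_inj | move: neq_col neqZA neqZB; rewrite eq_col eqxx].
pose i0 := Ordinal (ltnW d_gt1).
pose F := [set A | c (e ord0 A) == c (e ord0 [set i0])].
have : lubell_mass R F <= lambda_star R P d.
  apply: (lubell_mass_monochromatic (mono_free_embed (D := [set ord0]) free)).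
  by move=> A B; rewrite !inE => /eqP cA /eqP cB; apply: etrans cA (esym cB).
apply/negP; rewrite -ltNge; apply: lt_le_trans lt_middle _.
apply: lubell_mass_middle => A A0 AT; rewrite inE; apply/eqP.
(* [A] is linked to [[set i0]] through [[set i]] with [i] outside [A]: consecutive sets are equal or
   incomparable, as [A] is nonempty. *)
have [i iA] : exists i, i \notin A.
  by apply/existsP; apply: contraR AT; rewrite negb_exists => /forallP AT;
    apply/eqP/setP => i; rewrite inE; apply/negPn/AT.
transitivity (c (e ord0 [set i])).
  apply: same_colour; rewrite le_boolean_lattice ?sub1set //.
  by rewrite subset1 (negPf A0) orbF; apply: contraNneq iA => ->; rewrite inE.
have [->//|ne] := eqVneq i i0.
by apply: same_colour; rewrite le_boolean_lattice sub1set inE // eq_sym.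
Qed.

(** [B_1] is a two-element chain of mass 2, whose nonempty subposets are [C_1] and [C_2] only. *)
Lemma lambda_star1 : (0 < #|P|)%N ->
  ~ isomorphic P (chain 1) -> ~ isomorphic P (chain 2) ->
  2 <= lambda_star R P 1.
Proof.
move=> P_gt0 not1 not2; rewrite -(lubell_mass_setT 1).
apply: lubell_mass_strong_free => X _ [a [a_inj _ a_mono]].
have : (#|P| <= 2)%N.
  have <- : #|{: {set 'I_1}}| = 2%N.
    by rewrite -cardsT -powersetT card_powerset cardsT card_ord.
  exact: leq_card a_inj.
rewrite leq_eqVlt ltnS => /orP[/eqP card2|/fintype_le1P P_le1].
  have card_lt (A : {set 'I_1}) : (#|A| < 2)%N.
    by rewrite ltnS -[X in (_ <= X)%N](card_ord 1) max_card.
  (* Cardinality identifies [B_1] with the chain [C_2]. *)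
  pose f p : chain 2 := Ordinal (card_lt (a p)).
  have f_mono : {mono f : x y / (x <= y)%O}.
    move=> x y; rewrite le_chain -a_mono le_boolean_lattice /=.
    apply/idP/idP => [|/subset_leq_card //].
    have [->|[j jx]] := set_0Vmem (a x : {set 'I_1}); first by rewrite sub0set.
    move=> card_le; apply/subsetP => i _.
    have /card_gt0P[i' ] : (0 < #|(a y : {set 'I_1})|)%N.
      by apply: leq_trans card_le; apply/card_gt0P; exists j.
    by rewrite (ord1 i) (ord1 i').
  apply: not2; exists f => //; apply: inj_card_bij; first exact: inc_inj f_mono.
  by rewrite card_ord card2.
have /card_gt0P[p0 _] := P_gt0.
apply: not1; exists (fun=> ord0) => [|x y]; last by rewrite (P_le1 x y) !lexx.
by exists (fun=> p0) => x; [apply: P_le1 | rewrite [x]ord1].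
Qed.

(** * From arrow relations to bounds on [RRstar] *)

Lemma RRstar_le (dQ : Order.disp_t) (Q : finPOrderType dQ) n :
  rainbow_arrows P Q n -> (RRstar R P Q <= n%:R%:E)%E.
Proof.
move=> arrows; rewrite /RRstar; case: pselect => [h|[]].
  by case: ex_minnP => m _ /(_ n (asboolT arrows)); rewrite lee_fin ler_nat.
by exists n; apply/asboolP.
Qed.

Lemma RRstar_le_floor (dQ : Order.disp_t) (Q : finPOrderType dQ) m (x : R) :
  0 < x ->
  (forall (L : R) d, (forall n, lambda_star R P n <= L) ->
     x * L < d.+1%:R -> rainbow_arrows P Q (m + d)) ->
  (RRstar R P Q <= efloor (x%:E * lambda_star_max R P) + m%:R%:E)%E.
Proof.
move=> x_gt0 arrows.
have lam_le n : ((lambda_star R P n)%:E <= lambda_star_max R P)%E.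
  by apply: ereal_sup_ubound; exists n.
have lam_ge0 : 0 <= lambda_star R P 0 by apply: bigmax_ge_id.
case: lambda_star_max lam_le => [L||] lam_le.
(* If the supremum is [+oo], so is the right-hand side; [-oo] is excluded by the real value at
   [n = 0]. *)
2: by rewrite gt0_muley ?lte_fin //= addye // leey.
2: by have := lam_le 0.
have xL_ge0 : 0 <= x * L.
  by rewrite mulr_ge0 ?(ltW x_gt0) // (le_trans lam_ge0) // -lee_fin.
have := floorD1_gt (x * L); rewrite /=.
have : 0 <= Num.floor (x * L) by rewrite floor_ge0.
(* The nonnegative floor itself serves as the dimension [d], so that [x * L < d + 1]. *)
case: (Num.floor (x * L)) => // d _ lt_xL.
rewrite -EFinD -pmulrn -natrD addnC; apply: RRstar_le; apply: (arrows L) => //.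
by move: lt_xL; rewrite intrD -natr1.
Qed.

End Mass.

Theorem theorem1p7 (R : realType) (dP : Order.disp_t) (P : finPOrderType dP)
    (P_nonempty : (0 < #|P|)%N) :
  (forall k : nat, (2 <= k)%N ->
    (RRstar R P (antichain k)
       <= efloor ((k%:R - 1)%:E * lambda_star_max R P)
          + (central_bin_min k)%:R%:E)%E)
  /\
  (~ isomorphic P (chain 1) -> ~ isomorphic P (chain 2) ->
    (RRstar R P (antichain 3)
       <= efloor (2%:R%:E * lambda_star_max R P) + 2%:R%:E)%E).
Proof.
split=> [k k_ge2|not1 not2].
  apply: RRstar_le_floor => [|L d lam_le lt_d]; first by rewrite subr_gt0 ltr1n.
  apply: (rainbow_arrows_antichain k_ge2); apply: le_lt_trans lt_d.
  by rewrite ler_wpM2l // subr_ge0 ler1n ltnW.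
apply: RRstar_le_floor => // L d lam_le lt_d.
have := lambda_star1 R P_nonempty not1 not2.
have := lam_le 1; have := lam_le d => lam_d lam_1 ge2.
apply: (@rainbow_arrows_antichain3 R); first by lra.
(* As [L >= 2], [lambda_star R P d <= L <= 2 * L - 2 < d - 1]. *)
by move: lt_d; rewrite -natr1; have := lam_d; lra.
Qed.
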